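(* Let $M$ be a finite set of graphs and let $X$ be the class of all graphs that contain no graph from $M$ as an induced subgraph. Suppose that for at least one of the following four classes, $M$ contains no graph belonging to that class: (i) $P_3$-free graphs; (ii) complements of $P_3$-free graphs; (iii) forests; (iv) complements of forests. Then Ramsey numbers are not linear in $X$.
   Context: All graphs are finite, undirected, without loops or multiple edges. $P_3$ is the chordless path on 3 vertices. A graph is $H$-free if it has no induced subgraph isomorphic to $H$. A forest is a graph without cycles. For a class $X$ of graphs closed under taking induced subgraphs and positive integers $p,q$, $R_X(p,q)$ is the minimum $n$ such that every graph in $X$ with at least $n$ vertices has either a clique (set of pairwise adjacent vertices) of size $p$ or an independent set of size $q$. Ramsey numbers are called linear in $X$ if there is a constant $k$ such that $R_X(p,q)\le k(p+q)$ for all positive integers $p,q$. *)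

(* Defs.v *)
From Stdlib Require List.
From mathcomp Require Import all_boot.
From mathcomp Require Import boolp.

Set Implicit Arguments.
Unset Strict Implicit.
Unset Printing Implicit Defensive.

Record sgraph := SGraph {
  vertex :> finType;
  edge : rel vertex;
  edge_sym : symmetric edge;
  edge_irr : irreflexive edge }.

Arguments edge {s} x y.

(* Classes of graphs are predicates [sgraph -> Prop], and finite sets of graphs
   are lists, membership being [List.In]: [set sgraph] is rejected for universe
   reasons, as [sgraph] quantifies over all finite types. *)

Definition isomorphic (G H : sgraph) : Prop :=
  exists2 f : G -> H, bijective f & forall x y, edge (f x) (f y) = edge x y.

Section Complement.
Variable G : sgraph.

Definition compl_edge : rel G := fun x y => (x != y) && ~~ edge x y.

Lemma compl_edge_sym : symmetric compl_edge.
Proof. by move=> x y; rewrite /compl_edge eq_sym edge_sym. Qed.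

Lemma compl_edge_irr : irreflexive compl_edge.
Proof. by move=> x; rewrite /compl_edge eqxx. Qed.

Definition compl : sgraph := SGraph compl_edge_sym compl_edge_irr.

End Complement.

Section Induced.
Variables (G : sgraph) (A : {set G}).

Definition induced_edge : rel {x : G | x \in A} :=
  fun x y => edge (val x) (val y).

Lemma induced_edge_sym : symmetric induced_edge.
Proof. by move=> x y; rewrite /induced_edge edge_sym. Qed.

Lemma induced_edge_irr : irreflexive induced_edge.
Proof. by move=> x; rewrite /induced_edge edge_irr. Qed.

Definition induced : sgraph := SGraph induced_edge_sym induced_edge_irr.

End Induced.

Definition contains_induced (G H : sgraph) : Prop :=
  exists A : {set G}, isomorphic H (induced A).

Definition H_free (H G : sgraph) : Prop := ~ contains_induced G H.

Definition Free (M : seq sgraph) (G : sgraph) : Prop :=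
  forall H, List.In H M -> H_free H G.

Section Path.
Variable n : nat.

Definition path_edge : rel 'I_n := fun i j => (i.+1 == j) || (j.+1 == i).

Lemma path_edge_sym : symmetric path_edge.
Proof. by move=> i j; rewrite /path_edge orbC. Qed.

Lemma path_edge_irr : irreflexive path_edge.
Proof. by move=> i; rewrite /path_edge orbb eqn_leq ltnn. Qed.

Definition path_graph : sgraph := SGraph path_edge_sym path_edge_irr.

End Path.

Definition P3_free : sgraph -> Prop := H_free (path_graph 3).

(* The bound on the size discards [::], [:: x] and [:: x; y], which mathcomp
   also accepts as (unique) cycles. *)
Definition forest (G : sgraph) : Prop :=
  ~ exists2 c : seq G, 3 <= size c & ucycle edge c.

Definition complements (C : sgraph -> Prop) (G : sgraph) : Prop :=
  exists2 H, C H & isomorphic G (compl H).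

Definition clique (G : sgraph) (K : {set G}) : Prop :=
  {in K &, forall x y, x != y -> edge x y}.

Definition independent (G : sgraph) (K : {set G}) : Prop :=
  {in K &, forall x y, ~~ edge x y}.

Definition ramsey_prop (X : sgraph -> Prop) (p q n : nat) : Prop :=
  forall G : sgraph, X G -> n <= #|G| ->
    (exists2 K : {set G}, clique K & #|K| = p) \/
    (exists2 K : {set G}, independent K & #|K| = q).

(* Ramsey's theorem, needed for the minimum defining [ramsey] to exist. *)
Lemma ramsey_exists_in (p q : nat) :
  exists n, forall (G : sgraph) (A : {set G}), n <= #|A| ->
    (exists K : {set G}, [/\ K \subset A, clique K & #|K| = p]) \/
    (exists K : {set G}, [/\ K \subset A, independent K & #|K| = q]).
Proof.
elim: p q => [|p IHp] q.
  exists 0 => G A _; left; exists set0.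
  by split; [exact: sub0set | move=> x y; rewrite inE | rewrite cards0].
elim: q => [|q [n2 IHq]].
  exists 0 => G A _; right; exists set0.
  by split; [exact: sub0set | move=> x y; rewrite inE | rewrite cards0].
have [n1 {}IHp] := IHp q.+1.
exists (n1 + n2).+1 => G A leA.
have /card_gt0P[v vA] : 0 < #|A| by apply: leq_trans leA.
pose N := [set x in A :\ v | edge v x].
pose N' := [set x in A :\ v | ~~ edge v x].
have sN : N \subset A by apply/subsetP => x; rewrite !inE => /andP[/andP[]].
have sN' : N' \subset A by apply/subsetP => x; rewrite !inE => /andP[/andP[]].
have cA : #|N| + #|N'| = #|A :\ v|.
  rewrite -(cardsID [set x | edge v x] (A :\ v)).
  by congr (_ + _); apply: eq_card => x; rewrite !inE // andbC.
have {}leA : n1 + n2 <= #|N| + #|N'|.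
  by move: leA; rewrite cA (cardsD1 v A) vA add1n ltnS.
have [leN | ltN] := leqP n1 #|N|.
  case: (IHp G N leN) => [[K [sK cK eK]] | [K [sK iK eK]]]; last first.
    by right; exists K; split=> //; apply: subset_trans sN.
  left; exists (v |: K); split.
  - by rewrite subUset sub1set vA (subset_trans sK).
  - move=> x y; rewrite !inE => /orP[/eqP->|xK] /orP[/eqP->|yK].
    + by rewrite eqxx.
    + by move: (subsetP sK y yK); rewrite !inE => /andP[].
    + by move: (subsetP sK x xK); rewrite !inE edge_sym => /andP[].
    + exact: cK.
  - rewrite cardsU1 eK.
    by case: (boolP (v \in K)) => // /(subsetP sK); rewrite !inE eqxx.
have leN' : n2 <= #|N'|.
  rewrite leqNgt; apply/negP => lt2.
  by move: leA; rewrite leqNgt -addSn leq_add // ltnW.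
case: (IHq G N' leN') => [[K [sK cK eK]] | [K [sK iK eK]]].
  by left; exists K; split=> //; apply: subset_trans sN'.
right; exists (v |: K); split.
- by rewrite subUset sub1set vA (subset_trans sK).
- move=> x y; rewrite !inE => /orP[/eqP->|xK] /orP[/eqP->|yK].
  + by rewrite edge_irr.
  + by move: (subsetP sK y yK); rewrite !inE => /andP[].
  + by move: (subsetP sK x xK); rewrite !inE edge_sym => /andP[].
  + exact: iK.
- rewrite cardsU1 eK.
  by case: (boolP (v \in K)) => // /(subsetP sK); rewrite !inE eqxx.
Qed.

Lemma ramsey_exists (X : sgraph -> Prop) (p q : nat) :
  exists n, `[< ramsey_prop X p q n >].
Proof.
have [n Hn] := ramsey_exists_in p q; exists n; apply/asboolP => G _ leG.
have [|[K [_ cK eK]]|[K [_ iK eK]]] := Hn G [set: G]; first by rewrite cardsT.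
- by left; exists K.
- by right; exists K.
Qed.

Definition ramsey (X : sgraph -> Prop) (p q : nat) : nat :=
  ex_minn (ramsey_exists X p q).

(* A natural constant is no loss: a real one can always be rounded up. *)
Definition linear_ramsey (X : sgraph -> Prop) : Prop :=
  exists k : nat, forall p q : nat, 0 < p -> 0 < q ->
    ramsey X p q <= k * (p + q).

Definition disjoint_from (M : seq sgraph) (C : sgraph -> Prop) : Prop :=
  forall H, List.In H M -> ~ C H.

(* Main.v *)
(* If M contains no P3-free graph, X contains the disjoint union of m cliques of
   size m, which has m^2 vertices but no clique or independent set of size m+1.

   If M contains no forest, every graph of M has a cycle, of length at most some
   g, so X contains all graphs of girth larger than g. For p = 3 and g >= 3 it
   remains to find such graphs whose independence number is an arbitrarily small
   fraction of the number of vertices. As in Erdos's theorem on girth and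
   chromatic number, count over all graphs of constant average degree: the mean
   number of cycles of length at most g is bounded independently of n, and
   independent sets of size n / 2k are rare, so some graph has few short cycles
   and no such independent set; delete a vertex of each short cycle.

   The other two cases follow by exchanging graphs and complements. *)
Require Import Defs.
From mathcomp Require Import all_boot.
From mathcomp Require Import zify.

Set Implicit Arguments.
Unset Strict Implicit.
Unset Printing Implicit Defensive.

(** * Induced subgraphs, complements and superlinearity *)

Lemma contains_inducedP (G H : sgraph) :
  contains_induced G H <->
  exists2 f : H -> G, injective f & forall x y, edge (f x) (f y) = edge x y.
Proof.
split=> [[A [f /bij_inj f_inj fE]] | [f f_inj fE]].
  exists (fun x => val (f x)) => [x y /val_inj/f_inj // | x y].
  by rewrite -fE.
exists [set f x | x : H].
have fP x : f x \in [set f x | x : H] by rewrite imset_f.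
pose h x : induced [set f x | x : H] := exist _ (f x) (fP x).
exists h => [|x y]; last exact: fE.
apply: inj_card_bij => [x y /(congr1 val)/f_inj // |].
by rewrite card_sig (eq_card (B := mem [set f x | x : H])) // card_imset.
Qed.

Lemma contains_induced_trans (G H K : sgraph) :
  contains_induced G H -> contains_induced H K -> contains_induced G K.
Proof.
move=> /contains_inducedP[f f_inj fE] /contains_inducedP[h h_inj hE].
apply/contains_inducedP; exists (f \o h); first exact: inj_comp.
by move=> x y; rewrite /= fE hE.
Qed.

Lemma contains_compl (G H : sgraph) :
  contains_induced (compl G) H -> contains_induced G (compl H).
Proof.
move=> /contains_inducedP[f f_inj fE]; apply/contains_inducedP; exists f => //.
move=> x y; rewrite [RHS]/= /compl_edge -fE /= /compl_edge (inj_eq f_inj).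
by have [->|_] /= := eqVneq x y; rewrite ?edge_irr ?negbK.
Qed.

Lemma Free_compl (M : seq sgraph) (G : sgraph) :
  Free (map compl M) G -> Free M (compl G).
Proof.
by move=> MG H MH /contains_compl; apply: MG; apply: List.in_map.
Qed.

Lemma disjoint_from_compl (M : seq sgraph) (C : sgraph -> Prop) :
  disjoint_from M (complements C) -> disjoint_from (map compl M) C.
Proof.
move=> MC H /List.in_map_iff[H0 [<- MH0]] CH; apply: (MC _ MH0).
exists (compl H0) => //; exists id => [|x y /=]; first by exists id.
rewrite /compl_edge /= /compl_edge.
by have [->|_] /= := eqVneq x y; rewrite ?edge_irr ?negbK.
Qed.

(** For each constant [k], one graph refuting it. The condition is symmetric in cliques and
    independent sets, so it passes to complements by swapping [p] and [q]. *)
Definition superlinear (X : sgraph -> Prop) : Prop :=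
  forall k, exists G : sgraph, exists p q : nat,
    [/\ X G, (0 < p) && (0 < q), k * (p + q) <= #|G|,
        forall K : {set G}, clique K -> #|K| <> p
      & forall K : {set G}, independent K -> #|K| <> q].

Lemma superlinear_not_linear (X : sgraph -> Prop) :
  superlinear X -> ~ linear_ramsey X.
Proof.
move=> Xsup [k lin]; have [G [p [q [XG /andP[p0 q0] leG noK noI]]]] := Xsup k.
have := lin p q p0 q0; rewrite /ramsey.
case: ex_minnP => m /boolp.asboolP Pm _ lem.
by case: (Pm G XG (leq_trans lem leG)) => [[K /noK]|[K /noI]].
Qed.

Lemma superlinear_compl (M : seq sgraph) :
  superlinear (Free (map compl M)) -> superlinear (Free M).
Proof.
move=> sup k; have [G [p [q [XG /andP[p0 q0] leG noK noI]]]] := sup k.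
exists (compl G), q, p; split; rewrite ?p0 ?q0 1?addnC //.
- exact: Free_compl.
- move=> K cK; apply: noI => x y xK yK.
  have [<-|nxy] := eqVneq x y; first by rewrite edge_irr.
  by have := cK x y xK yK nxy; rewrite /= /compl_edge => /andP[].
- move=> K iK; apply: noK => x y xK yK nxy.
  by have := iK x y xK yK; rewrite /= /compl_edge nxy negbK.
Qed.

(** * Disjoint unions of cliques *)

Section DisjointCliques.
Variable m : nat.

Definition dcliques_edge : rel ('I_m * 'I_m) :=
  fun x y => (x.1 == y.1) && (x.2 != y.2).

Lemma dcliques_edge_sym : symmetric dcliques_edge.
Proof. by move=> x y; rewrite /dcliques_edge !(eq_sym y.1, eq_sym y.2). Qed.

Lemma dcliques_edge_irr : irreflexive dcliques_edge.
Proof. by move=> x; rewrite /dcliques_edge !eqxx. Qed.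

Definition dcliques : sgraph := SGraph dcliques_edge_sym dcliques_edge_irr.

Lemma dcliques_P3_free : P3_free dcliques.
Proof.
move=> /contains_inducedP[f f_inj fE].
pose i0 : 'I_3 := inord 0; pose i1 : 'I_3 := inord 1; pose i2 : 'I_3 := inord 2.
have := fE i0 i1; have := fE i1 i2; have := fE i0 i2.
rewrite /= /path_edge !inordK //= /dcliques_edge => e02.
move=> /andP[/eqP e12 _] /andP[/eqP e01 _].
move: e02; rewrite e01 e12 eqxx /= => /negbFE/eqP e2.
have /f_inj/(congr1 val) : f i0 = f i2.
  by apply: injective_projections; rewrite // e01.
by rewrite /= !inordK.
Qed.

Lemma dcliques_clique (K : {set dcliques}) : clique K -> #|K| <= m.
Proof.
move=> cK; rewrite -[X in _ <= X]card_ord -(card_in_imset (f := snd)) ?max_card //.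
move=> x y xK yK exy; apply/eqP; apply: contraT => /(cK x y xK yK).
by rewrite /= /dcliques_edge exy eqxx /= andbF.
Qed.

Lemma dcliques_independent (K : {set dcliques}) : independent K -> #|K| <= m.
Proof.
move=> iK; rewrite -[X in _ <= X]card_ord -(card_in_imset (f := fst)) ?max_card //.
move=> x y xK yK exy; have := iK x y xK yK.
rewrite /= /dcliques_edge exy eqxx negbK => /eqP e2.
exact: injective_projections.
Qed.

End DisjointCliques.

Lemma superlinear_P3_free (M : seq sgraph) :
  disjoint_from M P3_free -> superlinear (Free M).
Proof.
(* With m = 2k + 1 and p = q = m + 1, m^2 exceeds k(p + q) = 4k^2 + 4k by 1. *)
move=> MP k; exists (dcliques (2 * k).+1), (2 * k).+2, (2 * k).+2; split=> //.
- move=> H MH GH; apply: (MP H MH) => HP.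
  exact: dcliques_P3_free (contains_induced_trans GH HP).
- by rewrite card_prod !card_ord; nia.
- by move=> K /dcliques_clique leK eK; rewrite eK ltnn in leK.
- by move=> K /dcliques_independent leK eK; rewrite eK ltnn in leK.
Qed.

(** * Graphs of large girth *)

Definition girth_gt (g : nat) (G : sgraph) : Prop :=
  forall c : seq G, 3 <= size c -> ucycle edge c -> g < size c.

(** An induced copy of [H] in [G] would carry a cycle of [H], of length at most [g], to a cycle of
    [G]. *)
Lemma Free_girth_gt (M : seq sgraph) (g : nat) (G : sgraph) :
  disjoint_from M forest -> (forall H, List.In H M -> #|H| <= g) ->
  girth_gt g G -> Free M G.
Proof.
move=> MF Mg gG H MH /contains_inducedP[f f_inj fE].
apply: (MF H MH) => -[c c3 /andP[cc uc]].
have cg : size c <= g.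
  by apply: leq_trans (Mg H MH); rewrite -(card_uniqP uc) max_card.
suff /gG : ucycle edge (map f c) by rewrite size_map => /(_ c3); rewrite ltnNge cg.
rewrite /ucycle map_inj_uniq // uc andbT.
case: c c3 cc {uc cg} => [|x c] //= _; rewrite -map_rcons path_map.
by rewrite (eq_path (e' := edge)).
Qed.

Lemma clique_lt3 (g : nat) (G : sgraph) (K : {set G}) :
  3 <= g -> girth_gt g G -> clique K -> #|K| <> 3.
Proof.
move=> g3 gG cK eK.
have [x [y [z [[xK yK zK] [nxy nyz nzx]]]]] : exists x y z,
  [/\ x \in K, y \in K & z \in K] /\ [/\ x != y, y != z & z != x].
  by apply/card_gt2P; rewrite eK.
suff /gG : ucycle edge [:: x; y; z] by move=> /(_ isT); rewrite ltnNge g3.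
by rewrite /ucycle /= !inE negb_or nxy nyz !cK // eq_sym nzx.
Qed.

(** * Counting over random graphs *)

Section RandomFunctions.
Variables (T R : finType) (S : {set T}) (B : {set R}).

(** A random function maps [S] into [B] with probability (|B| / |R|)^|S|; denominators are cleared
    to stay in [nat]. *)
Lemma card_ffun_in :
  #|[set F : {ffun T -> R} | [forall x in S, F x \in B]]| * #|R| ^ #|S|
  = #|B| ^ #|S| * #|R| ^ #|T|.
Proof.
pose P x := if x \in S then mem B else mem R.
rewrite (eq_card (B := family P)); last first.
  move=> F; rewrite inE; apply/forall_inP/familyP => FP x.
    by rewrite /P; case: ifP => // /FP.
  by move=> xS; have := FP x; rewrite /P xS.
rewrite card_family foldrE big_map big_enum /= (bigID (mem S)) /=.
rewrite (eq_bigr (fun=> #|B|)) => [|x xS]; last by rewrite /P xS.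
rewrite prod_nat_const (eq_bigr (fun=> #|R|)) => [|x /negbTE xS]; last first.
  by rewrite /P xS.
rewrite prod_nat_const -mulnA -expnD addnC; congr (_ * _ ^ _).
by rewrite -[RHS](cardC S).
Qed.

End RandomFunctions.

Section CycleEdges.
Variable T : finType.

Definition cycle_edges (c : seq T) : {set {set T}} :=
  [set [set x; next c x] | x in c].

Lemma next_next_neq (c : seq T) x :
  uniq c -> 3 <= size c -> x \in c -> next c (next c x) != x.
Proof.
move=> uc c3 /rot_to[i s rs].
rewrite -[next c _](next_rot i uc) -[next c x](next_rot i uc) rs.
have : uniq (rot i c) by rewrite rot_uniq.
have : 3 <= size (rot i c) by rewrite size_rot.
rewrite rs; case: s {rs} => [|y [|z s]] //= _.
rewrite !inE !negb_or eqxx => /and3P[/and3P[nxy nxz _] _ _].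
rewrite (eq_sym y x) (negbTE nxy) eqxx. by rewrite eq_sym.
Qed.

(** Two vertices giving the same edge would be each other's successors, which forces length 2. *)
Lemma card_cycle_edges (c : seq T) :
  uniq c -> 3 <= size c -> #|cycle_edges c| = size c.
Proof.
move=> uc c3; rewrite -(card_uniqP uc); apply: card_in_imset => x y xc yc exy.
apply/eqP/negPn/negP => nxy.
have : x \in [set y; next c y] by rewrite -exy set21.
rewrite !inE (negbTE nxy) /= => /eqP ex.
have : y \in [set x; next c x] by rewrite exy set21.
rewrite !inE eq_sym (negbTE nxy) /= => /eqP ey.
by have := next_next_neq uc c3 xc; rewrite -ey -ex eqxx.
Qed.

End CycleEdges.

(* An edge function with values in s+1 colours models a random graph with edge
   probability 1/(s+1): an edge is a pair coloured 0. The values on sets that are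
   not pairs are irrelevant; they cancel in all the ratios. *)
Section RandomGraph.
Variables n s : nat.
Implicit Types F : {ffun {set 'I_n} -> 'I_s.+1}.

Definition rgraph_edge F : rel 'I_n :=
  fun x y => (x != y) && (F [set x; y] == ord0).

Lemma rgraph_edge_sym F : symmetric (rgraph_edge F).
Proof. by move=> x y; rewrite /rgraph_edge eq_sym setUC. Qed.

Lemma rgraph_edge_irr F : irreflexive (rgraph_edge F).
Proof. by move=> x; rewrite /rgraph_edge eqxx. Qed.

Definition rgraph F : sgraph :=
  SGraph (rgraph_edge_sym F) (rgraph_edge_irr F).

Definition ncycles l F := #|[set c : l.-tuple 'I_n | ucycleb (rgraph_edge F) c]|.

Definition indepb F (A : {set 'I_n}) :=
  [forall x in A, forall y in A, ~~ rgraph_edge F x y].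

Definition nindep (a : nat) F := #|[set A : {set 'I_n} | (#|A| == a) && indepb F A]|.

Let N := #|{ffun {set 'I_n} -> 'I_s.+1}|.

(** Each of the n^l tuples is a cycle with probability at most (s+1)^-l, since a cycle has l
    distinct edges; and n / (s+1) = K. *)
Lemma sum_ncycles l K : 3 <= l -> n = K * s.+1 ->
  \sum_F ncycles l F <= K ^ l * N.
Proof.
move=> l3 nE.
rewrite -(@leq_pmul2r (s.+1 ^ l)) ?expn_gt0 // mulnAC -expnMn -nE.
rewrite (eq_bigr (fun F => \sum_(c : l.-tuple 'I_n) ucycleb (rgraph_edge F) c)); last first.
  by move=> F _; rewrite /ncycles cardsE -sum1_card big_mkcond.
rewrite exchange_big /= big_distrl /=.
rewrite -[X in _ <= X ^ _ * _](card_ord n) -card_tuple -sum_nat_const.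
apply: leq_sum => c _.
have [uc|nuc] := boolP (uniq c); last first.
  by rewrite big1 // => F _; rewrite /ucycleb (negbTE nuc) andbF.
have := card_ffun_in (cycle_edges c) [set @ord0 s].
rewrite card_cycle_edges ?size_tuple // cards1 exp1n mul1n card_ord.
rewrite -[X in _ = X ^ _](card_ord s.+1) -card_ffun -/N => <-.
rewrite leq_mul2r; apply/orP; right; rewrite -big_mkcond sum1_card subset_leq_card //.
apply/subsetP => F; rewrite inE => /andP[cF _].
apply/forall_inP => e /imsetP[x xc ->]; rewrite inE.
by have /andP[] := next_cycle cF xc.
Qed.

(** A given [a]-set is independent with probability (s / (s+1))^C(a,2), and there are at most 2^n
    such sets. *)
Lemma sum_nindep (a : nat) :
  (\sum_F nindep a F) * s.+1 ^ 'C(a, 2) <= 2 ^ n * s ^ 'C(a, 2) * N.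
Proof.
rewrite (eq_bigr (fun F => \sum_(A : {set 'I_n}) (#|A| == a) && indepb F A)); last first.
  by move=> F _; rewrite /nindep cardsE -sum1_card big_mkcond.
rewrite exchange_big /= big_distrl /=.
have -> : 2 ^ n = #|{set 'I_n}|.
  by rewrite -cardsT -powersetT card_powerset cardsT card_ord.
rewrite -mulnA -sum_nat_const; apply: leq_sum => A _.
have [/eqP Aa|_] := boolP (#|A| == a); last by rewrite big1.
pose E := [set e : {set 'I_n} | e \subset A & #|e| == 2].
have := card_ffun_in E [set~ @ord0 s].
rewrite cards_draws Aa cardsC1 card_ord /=.
rewrite -[X in _ = _ * X ^ _](card_ord s.+1) -card_ffun -/N => <-.
rewrite leq_mul2r; apply/orP; right; rewrite -big_mkcond sum1_card subset_leq_card //.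
apply/subsetP => F; rewrite inE => /forall_inP iF.
apply/forall_inP => e; rewrite !inE => /andP[eA /cards2P[x [y [nxy eE]]]].
move: eA; rewrite eE subUset !sub1set => /andP[xA yA].
have /forall_inP/(_ y yA) := iF x xA.
by rewrite /rgraph_edge nxy.
Qed.

Lemma exists_few_cycles g a K :
  n = K * s.+1 -> 0 < n -> n * 2 ^ n * s ^ 'C(a, 2) <= s.+1 ^ 'C(a, 2) ->
  \sum_(3 <= l < g.+1) K ^ l + 1 < n ->
  exists2 F, \sum_(3 <= l < g.+1) ncycles l F <= \sum_(3 <= l < g.+1) K ^ l + 1
    & forall A : {set rgraph F}, independent A -> #|A| <> a.
Proof.
set C := (_ + 1) => nE n0 na Cn.
(* A total weight below n excludes independent a-sets, each of which weighs n,
   and leaves at most C short cycles. *)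
pose W F := \sum_(3 <= l < g.+1) ncycles l F + n * nindep a F.
have N0 : 0 < N by apply/card_gt0P; exists [ffun=> ord0].
have WC : \sum_F W F <= C * N.
  rewrite big_split /= mulnDl leq_add //.
    rewrite exchange_big big_distrl /= !big_nat leq_sum // => l /andP[l3 _].
    exact: sum_ncycles.
  (* By [na], the mean of [n * nindep a F] is at most 1: this is the [+ 1] in [C]. *)
  rewrite -big_distrr /= -(@leq_pmul2r (s.+1 ^ 'C(a, 2))) ?expn_gt0 // -mulnA.
  apply: leq_trans (leq_mul (leqnn n) (sum_nindep a)) _.
  by rewrite mul1n !mulnA [N * _]mulnC leq_mul2r na orbT.
(* Some [F] has weight at most the mean. *)
have [F WF] : exists F, W F <= C.
  apply/existsP; apply: contraLR WC => /existsPn nW; rewrite -ltnNge.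
  apply: (@leq_trans (C.+1 * N)); first by rewrite ltn_pmul2r.
  rewrite mulnC -sum_nat_const; apply: leq_sum => F _.
  by rewrite ltnNge nW.
exists F; first exact: leq_trans (leq_addr _ _) WF.
move=> A iA eA; suff : 0 < nindep a F.
  by move=> i0; move: WF Cn; rewrite /W; nia.
apply/card_gt0P; exists A; rewrite inE eA eqxx /=.
by apply/forall_inP => x xA; apply/forall_inP => y yA; exact: iA.
Qed.

End RandomGraph.

(** * Numerical estimates *)

(** Bernoulli's inequality (1 + 1/t)^m >= 1 + m/t, multiplied by t^(m+1). *)
Lemma bernoulli_expn t m : (t + m) * t ^ m <= t * t.+1 ^ m.
Proof.
elim: m => [|m IHm]; first by rewrite addn0 !expn0.
rewrite !expnSr mulnA; have := leq_mul IHm (leqnn t.+1); nia.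
Qed.

Lemma double_expn_pred t : 2 * t ^ t.+1 <= t.+1 ^ t.+1.
Proof.
case: (posnP t) => [->|t0]; first by rewrite exp0n.
rewrite -(leq_pmul2l t0) (leq_trans _ (bernoulli_expn t t.+1)) // mulnA.
rewrite leq_mul2r; apply/orP; right; lia.
Qed.

(** * Deleting short cycles and choosing the parameters *)

Lemma card_bigcup_le (I : Type) (T : finType) (r : seq I) (B : I -> {set T})
    (m : I -> nat) :
  (forall i, #|B i| <= m i) -> #|\bigcup_(i <- r) B i| <= \sum_(i <- r) m i.
Proof.
move=> Bm; elim/big_rec2: _ => [|i k A _ Ak]; first by rewrite cards0.
by apply: leq_trans (leq_card_setU _ _) _; apply: leq_add.
Qed.

(** [D] collects the first vertex of every short cycle, so a short cycle avoiding [D] would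
    contradict its own head. [x0] serves as the default of [head]. *)
Lemma delete_cycles (G : sgraph) (x0 : G) g :
  exists2 D : {set G},
    #|D| <= \sum_(3 <= l < g.+1) #|[set c : l.-tuple G | ucycleb edge c]|
  & girth_gt g (induced (~: D)).
Proof.
exists (\bigcup_(3 <= l < g.+1)
          [set head x0 c | c : l.-tuple G in
             [set c : l.-tuple G | ucycleb edge c]]).
  by apply: card_bigcup_le => l; apply: leq_imset_card.
set D := \bigcup_(_ <= _ < _) _.
have headD (c : seq G) : 3 <= size c <= g -> ucycle edge c -> head x0 c \in D.
  move=> /andP[c3 cg] uc.
  rewrite /D (bigD1_seq (size c)) ?mem_index_iota ?iota_uniq ?c3 //= inE.
  by apply/orP; left; apply/imsetP; exists (in_tuple c) => //; rewrite inE.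
clearbody D => c c3 /andP[cc uc]; rewrite ltnNge; apply/negP => cg.
have : head x0 (map val c) \in D.
  apply: headD; first by rewrite size_map c3.
  rewrite /ucycle (map_inj_uniq val_inj) uc andbT.
  by case: c c3 cc {uc cg} => [|x c] //= _; rewrite -map_rcons path_map.
by case: c c3 {cc uc cg} => [|x c] //= _ xD; have := valP x; rewrite inE xD.
Qed.

Lemma exists_girth_gt g k :
  exists G : sgraph, exists2 q, 0 < q & [/\ k * (3 + q) <= #|G|, girth_gt g G
    & forall A : {set G}, independent A -> #|A| <> q].
Proof.
(* The size [a] chosen below is a multiple of [k] and must be positive; a graph for k + 1 also
   serves for k. *)
wlog k0 : k / 0 < k.
  move=> W; have [G [q q0 [leG gG iG]]] := W k.+1 isT.
  exists G, q => //; split=> //; apply: leq_trans leG.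
  by rewrite leq_mul2r leqnSn orbT.
(* Edge probability 1/t with t = s+1, so that the expected number of l-cycles is
   at most (n/t)^l = K^l whatever t is; t is then taken large compared with C. *)
pose K := 32 * k ^ 2; pose C := \sum_(3 <= l < g.+1) K ^ l + 1.
(* [K] is such that a = n / 2k: half of [n] covers k * a, the other half the deleted vertices and
   3k. The factor 16 yields [m0] below. *)
pose s := C.+2; pose a := 16 * k * s.+1; pose n := K * s.+1.
have K0 : 0 < K by rewrite /K; nia.
have n0 : 0 < n by rewrite /n muln_gt0 K0.
have na : n = 2 * k * a by rewrite /n /a /K; nia.
have Cn : C < n by rewrite /n /s; nia.
have Cka : C + k * (3 + a) <= n by rewrite na /a /s; nia.
have dense : n * 2 ^ n * s ^ 'C(a, 2) <= s.+1 ^ 'C(a, 2).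
  (* The C(a,2) pairs form [m] blocks of s + 1, each contributing a factor at most 1/2 by
     [double_expn_pred]; as m >= 2n, this beats n * 2^n <= 2^(2n). *)
  pose m := 8 * k * a.-1.
  have aE : 'C(a, 2) = s.+1 * m.
    have -> : 'C(a, 2) = (a * a.-1)./2 by rewrite bin2.
    by rewrite -[RHS]doubleK; congr _./2; rewrite -muln2 /m {1}/a; nia.
  rewrite aE !(expnM _ s.+1 m); have m0 : 2 * n <= m by rewrite na /m /a; nia.
  apply: (@leq_trans (2 ^ m * (s ^ s.+1) ^ m)).
    rewrite leq_mul2r; apply/orP; right; apply: leq_trans (leq_pexp2l _ m0) => //.
    by rewrite mul2n -addnn expnD leq_mul2r ltnW ?orbT // ltn_expl.
  by rewrite -expnMn leq_exp2r ?double_expn_pred // (leq_trans _ m0) // muln_gt0 n0.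
have [F FC iF] := exists_few_cycles (erefl n) n0 dense Cn.
have [D DC gD] := @delete_cycles (rgraph F) (Ordinal n0) g.
have {}DC : #|D| <= C by apply: leq_trans FC.
exists (induced (~: D)), a; first by rewrite /a; nia.
split=> //.
  have : #|D| + #|induced (~: D)| = n.
    have -> : #|induced (~: D)| = #|~: D| by rewrite card_sig; apply: eq_card.
    by rewrite cardsC; apply: card_ord.
  move=> cD; rewrite -(leq_add2l #|D|) cD (leq_trans _ Cka) //.
  by rewrite leq_add2r.
move=> A iA; rewrite -(card_imset _ val_inj); apply: iF.
by move=> _ _ /imsetP[x xA ->] /imsetP[y yA ->]; apply: (iA x y xA yA).
Qed.

Lemma superlinear_forest (M : seq sgraph) :
  disjoint_from M forest -> superlinear (Free M).
Proof.
(* The sum bounds the order of every graph in [M]; the 3 rules out triangles. *)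
move=> MF k; pose g := 3 + \sum_(H <- M) #|H|.
have [G [q q0 [leG gG iG]]] := exists_girth_gt g k.
exists G, 3, q; split=> //.
  apply: Free_girth_gt MF _ gG => H MH; rewrite /g; apply: leq_trans (leq_addl _ _).
  elim: M MH {g leG} => [|H' M IHM] //=; rewrite big_cons => -[->|/IHM].
    exact: leq_addr.
  by move=> leH; apply: leq_trans (leq_addl _ _).
by move=> K; apply: clique_lt3 gG.
Qed.

Theorem theorem2 (M : seq sgraph) :
  disjoint_from M P3_free \/
  disjoint_from M (complements P3_free) \/
  disjoint_from M forest \/
  disjoint_from M (complements forest) ->
  ~ linear_ramsey (Free M).
Proof.
move=> MC; apply: superlinear_not_linear.
case: MC => [|[|[|]]].
- exact: superlinear_P3_free.
- by move=> /disjoint_from_compl/superlinear_P3_free/superlinear_compl.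
- exact: superlinear_forest.
- by move=> /disjoint_from_compl/superlinear_forest/superlinear_compl.
Qed.
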